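(* Let $p>2$ be a prime and let $\varphi\in\mathbb{C}^{\{1,\ldots,p-1\}}$ be such that: (i) $c_\varphi(\chi)=\sum_{l=1}^{p-1}|\varphi(-l)|^2\chi(l)\neq 0$ for every $\chi\in\widehat{\mathbb{Z}_p^*}$; (ii) the matrix $B_\varphi\in\mathbb{C}^{\{1,\ldots,p-1\}\times\{1,\ldots,p-2\}}$, $B_\varphi(m,n)=\varphi(mn)\overline{\varphi(m(n+1))}$, has a left inverse $B_\varphi^\dagger\in\mathbb{C}^{\{1,\ldots,p-2\}\times\{1,\ldots,p-1\}}$. Let $\Omega_0\in\mathbb{C}^{\{1,\ldots,p-1\}\times\{1,\ldots,p-1\}}$ be the matrix of the linear map $(\Omega_0f)(m)=f(-m)$, and let $\Omega_1\in\mathbb{C}^{\{1,\ldots,p-2\}\times\{2,\ldots,p-1\}}$ be the matrix of the linear map $(\Omega_1f)(n)=f(1+n^{-1})$. Let $A\in\mathbb{C}^{\{1,\ldots,p-1\}\times\{1,\ldots,p-1\}}$ and let $F\in\mathbb{C}^G$ be defined by $$F(k,l)=\langle A\,\widehat{\pi}_0(k,l)\varphi,\widehat{\pi}_0(k,l)\varphi\rangle .$$ Then $A$ can be recovered from $F$ by the following steps: (1) Define $a_1\in\mathbb{C}^{\{1,\ldots,p-1\}}$ by $$a_1(k)=\frac{1}{p(p-1)}\sum_{\chi\in\widehat{\mathbb{Z}_p^*}}c_\varphi(\chi)^{-1}\,\tilde{\chi}(F)\,\chi(k).$$ (2) Define $A_2'=p^{-1}\cdot\widehat{\pi}_0(F)\cdot\Omega_0^T\cdot(B_\varphi^\dagger)^*\cdot\Omega_1\in\mathbb{C}^{\{1,\ldots,p-1\}\times\{2,\ldots,p-1\}}$.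 (3) Then $$A=S^*\big((a_1|A_2')\big),$$ where $(a_1|A_2')\in\mathbb{C}^{\{1,\ldots,p-1\}\times\{1,\ldots,p-1\}}$ is the matrix whose column with index $1$ is $a_1$ and whose columns with indices $2,\ldots,p-1$ are those of $A_2'$. In particular, any nonzero $f\in\mathbb{C}^{\{1,\ldots,p-1\}}$ can be recovered up to a phase factor from the function $F(k,l)=|\langle f,\widehat{\pi}_0(k,l)\varphi\rangle|^2$ on $G$: applying steps (1)-(3) to this $F$ yields a matrix $A$, and $f$ is, up to a factor in $\mathbb{T}$, the eigenvector associated to the nonzero eigenvalue of $A$, normalized by $\|f\|_2^2=\mathrm{trace}(A)$.
   Context: All arithmetic on indices in $\{0,1,\ldots,p-1\}$ (including inverses) is in the field $\mathbb{Z}_p=\mathbb{Z}/p\mathbb{Z}$. $\mathbb{Z}_p^*=\mathbb{Z}_p\setminus\{0\}$ is the multiplicative group, identified as a set with $\{1,\ldots,p-1\}$; $\mathbb{T}=\{z\in\mathbb{C}:|z|=1\}$; $\widehat{\mathbb{Z}_p^*}$ is the group of characters $\chi:\mathbb{Z}_p^*\to\mathbb{T}$. $G=\mathbb{Z}_p\rtimes\mathbb{Z}_p^*$ is the affine group: the set $\mathbb{Z}_p\times\mathbb{Z}_p^*$ with group law $(k,l)(k',l')=(k+lk',ll')$. For finite sets $X,Y$, $\mathbb{C}^{X\times Y}$ is the space of complex matrices with rows indexed by $X$ and columns indexed by $Y$, with scalar product $\langle A,B\rangle=\mathrm{trace}(AB^* )$; scalar products are linear in the first argument. The unitary representation $\widehat{\pi}_0$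 of $G$ acts on $\mathbb{C}^{\{1,\ldots,p-1\}}$ by $(\widehat{\pi}_0(k,l)f)(m)=e^{-2\pi ikm/p}f(lm)$. For $F\in\mathbb{C}^G$ and $\chi\in\widehat{\mathbb{Z}_p^*}$ put $$\tilde{\chi}(F)=\sum_{l\in\mathbb{Z}_p^*}\Big(\sum_{k\in\mathbb{Z}_p}F(k,l)\Big)\chi(l),\qquad \widehat{\pi}_0(F)=\sum_{(k,l)\in G}F(k,l)\,\widehat{\pi}_0(k,l)\in\mathbb{C}^{\{1,\ldots,p-1\}\times\{1,\ldots,p-1\}}.$$ $S$ is the unitary operator on $\mathbb{C}^{\{1,\ldots,p-1\}\times\{1,\ldots,p-1\}}$ given by $$(SA)(m,n)=\begin{cases}A(-m,-m)& n=1,\\ A(m(1-n)^{-1},mn(1-n)^{-1})& n\in\{2,\ldots,p-1\},\end{cases}$$ with adjoint (inverse) $$(S^*A)(m,n)=\begin{cases}A(-m,1)& n=m,\\ A(m-n,m^{-1}n)& m\neq n.\end{cases}$$ *)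

(* Defs.v *)
From HB Require Import structures.
From mathcomp Require Import all_boot all_order all_fingroup all_algebra.
From mathcomp Require Import all_classical reals trigo.
From mathcomp Require Import complex.
Set Implicit Arguments.
Unset Strict Implicit.
Unset Printing Implicit Defensive.
Import Order.TTheory GRing.Theory Num.Theory.
Local Open Scope classical_set_scope.
Local Open Scope sesquilinear_scope.
Local Open Scope ring_scope.

(* For a prime p > 2, dim1 p = p - 1 and dim2 p = p - 2.  Both are literal
   successors, so that [inord] is available, and dim1 p is convertible to
   1 + dim2 p.  The three index sets of the matrices below are encoded by
     {1,...,p-1} ~ 'I_(dim1 p),  i |-> i.+1,
     {1,...,p-2} ~ 'I_(dim2 p),  i |-> i.+1,
     {2,...,p-1} ~ 'I_(dim2 p),  i |-> i.+2.  *)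
Notation dim2 p := (p - 3).+1.
Notation dim1 p := (dim2 p).+1.

(* The element of Z_p carried by a position, when counting from 1 or from 2. *)
Definition el1 p n (i : 'I_n) : 'F_p := i.+1%:R.
Definition el2 p n (i : 'I_n) : 'F_p := i.+2%:R.

(* The position of an element of Z_p in {1,...,p-1}, resp. {2,...,p-1};
   irrelevant outside of these sets. *)
Definition pos1 p (x : 'F_p) : 'I_(dim1 p) := inord (x - 1)%N.
Definition pos2 p (x : 'F_p) : 'I_(dim2 p) := inord (x - 2)%N.

(* The element of Z_p^* carried by a position of {1,...,p-1}; the default
   value 1 is not used when p > 2 is prime. *)
Definition unit1 p (i : 'I_(dim1 p)) : {unit 'F_p} := insubd (1%g : {unit 'F_p}) (el1 p i).

(* The underlying set of the affine group Z_p \rtimes Z_p^*. *)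
Notation aff p := ('F_p * {unit 'F_p})%type.

Section Definitions.
Variables (R : realType) (p : nat).
Local Notation C := R[i].

(* expi x = exp (i x) *)
Definition expi (x : R) : C := (cos x +i* sin x)%C.

(* On column vectors this is the scalar product \sum_m f(m) g(m)^*. *)
Definition hsdot m n (A B : 'M[C]_(m, n)) : C := \tr (A *m B ^t*).

(* The matrix of a linear map, acting on column vectors. *)
Definition mx_of_map m n (T : 'cV[C]_n -> 'cV[C]_m) : 'M[C]_(m, n) :=
  \matrix_(i, j) T (delta_mx j 0) i 0.

Definition pi0 (g : aff p) : 'M[C]_(dim1 p) :=
  mx_of_map (fun f => \col_(i < dim1 p)
    (expi (- (2 * pi * (g.1 * el1 p i)%R%:R / p%:R))
     * f (pos1 (val g.2 * el1 p i)) 0)).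

Definition pi0_hat (F : aff p -> C) : 'M[C]_(dim1 p) :=
  \sum_(g : aff p) F g *: pi0 g.

(* The characters of Z_p^* with values in the unit circle. *)
Definition char_group : set {ffun {unit 'F_p} -> C} :=
  [set chi | (forall l, `|chi l| = 1) /\
             (forall l l', chi (l * l')%g = chi l * chi l')].

Definition chi_tilde (chi : {unit 'F_p} -> C) (F : aff p -> C) : C :=
  \sum_(l : {unit 'F_p}) (\sum_(k : 'F_p) F (k, l)) * chi l.

Definition c_coef (phi : 'cV[C]_(dim1 p)) (chi : {unit 'F_p} -> C) : C :=
  \sum_(l : {unit 'F_p}) `|phi (pos1 (- val l)) 0| ^+ 2 * chi l.

Definition Bmx (phi : 'cV[C]_(dim1 p)) : 'M[C]_(dim1 p, dim2 p) :=
  \matrix_(i, j) (phi (pos1 (el1 p i * el1 p j)) 0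
                  * (phi (pos1 (el1 p i * (el1 p j + 1))) 0)^*).

Definition Omega0 : 'M[C]_(dim1 p) :=
  mx_of_map (fun f => \col_(i < dim1 p) f (pos1 (- el1 p i)) 0).

(* Columns indexed by {2,...,p-1}, rows indexed by {1,...,p-2}. *)
Definition Omega1 : 'M[C]_(dim2 p) :=
  mx_of_map (fun f => \col_(i < dim2 p) f (pos2 (1 + (el1 p i)^-1)) 0).

Definition Sop (A : 'M[C]_(dim1 p)) : 'M[C]_(dim1 p) :=
  \matrix_(i, j)
    let m := el1 p i in let n := el1 p j in
    if n == 1 then A (pos1 (- m)) (pos1 (- m))
    else A (pos1 (m * (1 - n)^-1)) (pos1 (m * n * (1 - n)^-1)).

(* The adjoint, and inverse, of Sop, by its explicit formula. *)
Definition Sadj (A : 'M[C]_(dim1 p)) : 'M[C]_(dim1 p) :=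
  \matrix_(i, j)
    let m := el1 p i in let n := el1 p j in
    if n == m then A (pos1 (- m)) (pos1 1)
    else A (pos1 (m - n)) (pos1 (m^-1 * n)).

(* The sum over the (finite) set of characters is a finitely supported sum. *)
Definition step1 (phi : 'cV[C]_(dim1 p)) (F : aff p -> C) : 'cV[C]_(dim1 p) :=
  \col_i ((p * (p - 1))%:R^-1 *
    \sum_(chi \in char_group)
      ((c_coef phi chi)^-1 * chi_tilde chi F * chi (unit1 i))).

Definition step2 (Bd : 'M[C]_(dim2 p, dim1 p)) (F : aff p -> C) :
    'M[C]_(dim1 p, dim2 p) :=
  p%:R^-1 *: (pi0_hat F *m Omega0^T *m Bd ^t* *m Omega1).

Definition reconstruct (phi : 'cV[C]_(dim1 p)) (Bd : 'M[C]_(dim2 p, dim1 p))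
    (F : aff p -> C) : 'M[C]_(dim1 p) :=
  Sadj (row_mx (step1 phi F) (step2 Bd F)).

End Definitions.

Arguments char_group : clear implicits.

(* Main.v *)
(* With psi(k) = e^(-2 pi i k / p), the entry formula
   F(k,l) = sum_(m,n) psi(k(n-m)) A(m,n) phi(ln) phi(lm)^*
   shows that Fourier inversion in k isolates the diagonals m - n = y of A.
   For y = 0 this leaves the convolution of the main diagonal of A with
   |phi|^2 on Z_p^*, which orthogonality of the characters inverts; for
   y = i in Z_p^* it leaves row i of the equation
   pi0_hat(F) Omega0^T = p M (Bmx phi)^*, where M(i,t) = A(-it, -i(t+1)),
   that is, where M Omega1 consists of the columns 2, ..., p-1 of S A.
   For the second part, |<f, v>|^2 = <f f^* v, v>, so that the reconstructed
   matrix is f f^*. *)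
Require Import Defs.
From HB Require Import structures.
From mathcomp Require Import all_boot all_order all_fingroup all_algebra.
From mathcomp Require Import cyclic separable cyclotomic.
From mathcomp Require Import all_classical reals trigo.
From mathcomp Require Import complex ring.
Import Order.TTheory GRing.Theory Num.Theory.
Local Open Scope classical_set_scope.
Local Open Scope ring_scope.

(** * Positions and the residues modulo [p] that they carry *)

Section PrimeField.
Variables (p : nat) (p_prime : prime p).

Lemma ltn_Fp (x : 'F_p) : (x < p)%N.
Proof. by rewrite -[X in (_ < X)%N](Fp_cast p_prime) ltn_ord. Qed.

Lemma val_el1 n (i : 'I_n) : (n < p)%N -> el1 p i = i.+1 :> nat.
Proof.
by move=> lt_np; rewrite val_Fp_nat // modn_small //
  (leq_ltn_trans (ltn_ord i)).
Qed.

Lemma val_el2 n (i : 'I_n) : (n.+1 < p)%N -> el2 p i = i.+2 :> nat.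
Proof.
move=> lt_np; rewrite val_Fp_nat // modn_small //.
by apply: leq_ltn_trans lt_np; rewrite ltnS ltn_ord.
Qed.

Lemma el1_inj n : (n < p)%N -> injective (@el1 p n).
Proof.
move=> lt_np i j /(congr1 (@nat_of_ord _)).
by rewrite !val_el1 // => -[] /val_inj.
Qed.

Lemma el2_inj n : (n.+1 < p)%N -> injective (@el2 p n).
Proof.
move=> lt_np i j /(congr1 (@nat_of_ord _)).
by rewrite !val_el2 // => -[] /val_inj.
Qed.

Lemma el1_neq0 n (i : 'I_n) : (n < p)%N -> el1 p i != 0.
Proof. by move=> lt_np; rewrite -(inj_eq (@ord_inj _)) val_el1. Qed.

Lemma el1_inord n (x : 'F_p) :
  (0 < x <= n.+1)%N -> el1 p (inord (x - 1) : 'I_n.+1) = x.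
Proof.
move=> /andP[x_gt0 lexn].
rewrite /el1 inordK ?subn1 ?prednK //; apply: ord_inj.
by rewrite val_Fp_nat // modn_small ?ltn_Fp.
Qed.

Lemma el2_inord n (x : 'F_p) :
  (1 < x <= n.+2)%N -> el2 p (inord (x - 2) : 'I_n.+1) = x.
Proof.
move=> /andP[x_gt1 lexn].
rewrite /el2 inordK; last first.
  by rewrite subn2; case: (x : nat) x_gt1 lexn => [|[|]].
rewrite -[in LHS]addn2 subnK //; apply: ord_inj.
by rewrite val_Fp_nat // modn_small ?ltn_Fp.
Qed.

Hypothesis p_gt2 : (2 < p)%N.

Lemma dim1E : dim1 p = (p - 1)%N.
Proof. by case: p p_gt2 => [|[|[|n]]] // _; rewrite !subSS !subn0. Qed.

Lemma ltn_dim1 : (dim1 p < p)%N.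
Proof. by rewrite dim1E; case: p p_gt2 => // n _; rewrite subn1. Qed.

Lemma ltn_dim2 : (dim2 p < p)%N.
Proof. exact: ltnW ltn_dim1. Qed.

Lemma el1K : cancel (@el1 p (dim1 p)) (@pos1 p).
Proof.
move=> i; rewrite /pos1 val_el1 ?ltn_dim1 // subn1.
exact: inord_val.
Qed.

Lemma pos1K (x : 'F_p) : x != 0 -> el1 p (pos1 x) = x.
Proof.
rewrite -(inj_eq (@ord_inj _)) -lt0n => x_gt0; apply: el1_inord.
by rewrite x_gt0 dim1E -ltnS subn1 prednK ?ltn_Fp // ltnW // ltnW.
Qed.

Lemma pos2K (x : 'F_p) : x != 0 -> x != 1 -> el2 p (pos2 x) = x.
Proof.
rewrite -!(inj_eq (@ord_inj _)) => x_neq0 x_neq1; apply: el2_inord.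
apply/andP; split; first by case: (x : nat) x_neq0 x_neq1 => [|[|]].
by rewrite dim1E -ltnS subn1 prednK ?ltn_Fp // ltnW // ltnW.
Qed.

(* The position of x in {1,...,p-2}; junk for x = 0 and x = -1. *)
Definition pos_dim2 (x : 'F_p) : 'I_(dim2 p) := inord (x - 1).

Lemma pos_dim2K (x : 'F_p) : x != 0 -> x + 1 != 0 -> el1 p (pos_dim2 x) = x.
Proof.
move=> x_neq0 x1_neq0; apply: el1_inord; move: x_neq0.
rewrite -(inj_eq (@ord_inj _)) -lt0n => ->; rewrite -ltnS dim1E -ltnS subn1.
rewrite prednK; last by rewrite ltnW // ltnW.
(* The only nonzero residue outside {1,...,p-2} is p - 1, whose successor is 0 in the field. *)
rewrite ltn_neqAle ltn_Fp andbT; apply: contraNN x1_neq0 => /eqP def_p.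
by rewrite -[x]natr_Zp -(natrD _ _ 1) addn1 def_p pchar_Fp_0.
Qed.

Lemma el1_dim2_neq (t : 'I_(dim2 p)) : el1 p t + 1 != 0.
Proof.
rewrite /el1 -(natrD _ _ 1) addn1 -(inj_eq (@ord_inj _)).
rewrite val_Fp_nat // modn_small //.
by apply: leq_ltn_trans ltn_dim1; rewrite ltnS; apply: ltn_ord.
Qed.

Lemma el2_neq (s : 'I_(dim2 p)) : (el2 p s != 0) * (el2 p s != 1).
Proof. by rewrite -!(inj_eq (@ord_inj _)) val_el2 // ltn_dim1. Qed.

Lemma val_unit1 (i : 'I_(dim1 p)) : val (unit1 i) = el1 p i.
Proof.
by apply: insubdK; rewrite -topredE /= unitfE el1_neq0 // ltn_dim1.
Qed.

Lemma unit_neq0 (u : {unit 'F_p}) : val u != 0.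
Proof. by have := valP u; rewrite unitfE. Qed.

End PrimeField.

(** * The additive character of Z_p and its orthogonality relation *)

Section AdditiveCharacter.
Variable R : realType.

Lemma expiD (x y : R) : expi (x + y) = expi x * expi y.
Proof.
apply/eqP; rewrite eq_complex /= cosD sinD eqxx /=.
by rewrite addrC.
Qed.

Lemma expi0 : expi (0 : R) = 1.
Proof. by rewrite /expi cos0 sin0. Qed.

Lemma expiMn (x : R) n : expi (x *+ n) = expi x ^+ n.
Proof.
by elim: n => [|n IHn]; rewrite ?mulr0n ?expi0 // mulrS expiD IHn exprS.
Qed.

Variables (p : nat) (p_prime : prime p).

Definition psi (x : 'F_p) : R[i] := expi (- (2 * pi * x%:R / p%:R)).

Let w := expi (- (2 * pi / p%:R) : R).

Lemma psiE x : psi x = w ^+ x.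
Proof. rewrite /psi -expiMn mulNrn; congr (expi (- _)).
by rewrite -[RHS]mulr_natr mulrAC. Qed.

Lemma w_expp : w ^+ p = 1.
Proof.
rewrite -expiMn mulNrn -[_ *+ p]mulr_natr divfK ?pnatr_eq0 -?lt0n ?prime_gt0 //.
by rewrite mulrC mulr_natr /expi cosN sinN cos2pi sin2pi oppr0.
Qed.

(** Addition in ['F_p] reduces modulo [p], which is harmless in the exponent of [w] because
    [w ^+ p = 1]. *)
Lemma psiD x y : psi (x + y) = psi x * psi y.
Proof.
have DxyE : nat_of_ord (x + y)%R = ((x + y) %% p)%N.
  by rewrite /= [X in (_ %% X)%N](Fp_cast p_prime).
by rewrite !psiE -exprD DxyE expr_mod // w_expp.
Qed.

Lemma psi0 : psi 0 = 1.
Proof. by rewrite psiE expr0. Qed.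

Lemma psi_neq0 x : psi x != 0.
Proof.
apply/eqP => px0; have := psiD x (- x); rewrite subrr psi0 px0 mul0r.
by apply/eqP; rewrite oner_eq0.
Qed.

(** Values of [psi] are [p]-th roots of unity, hence of modulus 1, so conjugation is inversion. *)
Lemma psi_conj x : (psi x)^* = psi (- x).
Proof.
have <- : (psi x)^-1 = psi (- x).
  apply: (mulfI (psi_neq0 x)); rewrite mulfV ?psi_neq0 //.
  by rewrite -psiD subrr psi0.
have nx : `|psi x| ^+ p = 1.
  by rewrite -normrX psiE exprAC w_expp expr1n normr1.
have : `|psi x| == 1.
  by rewrite -(@pexpr_eq1 _ _ p) ?nx ?prime_gt0.
by move=> /eqP n1; rewrite invC_norm n1 expr1n invr1 mul1r.
Qed.

Hypothesis p_gt2 : (2 < p)%N.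

(** The imaginary part is -sin(2 pi / p), which is nonzero because p > 2 puts 2 pi / p strictly
    between 0 and pi. *)
Lemma psi1_neq1 : psi 1 != 1.
Proof.
rewrite psiE /= expr1; apply/eqP => /(congr1 (fun z => complex.Im z)) /=.
apply/eqP; rewrite sinN oppr_eq0 gt_eqF // sin_gt0_pi //.
rewrite divr_gt0 ?mulr_gt0 ?pi_gt0 ?ltr0n ?prime_gt0 //=.
by rewrite ltr_pdivrMr ?ltr0n ?prime_gt0 // mulrC ltr_pM2l ?pi_gt0 // ltr_nat.
Qed.

Lemma psi_sum x : \sum_k psi (k * x) = p%:R * (x == 0)%:R.
Proof.
have [->|x_neq0] := eqVneq x 0.
  rewrite mulr1 (eq_bigr (fun=> 1)) => [|k _]; last by rewrite mulr0 psi0.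
  by rewrite sumr_const card_Fp.
rewrite mulr0; apply/eqP; set S := \sum_k _.
(* Translating [k] by [x^-1] multiplies each term by [psi 1]; as [psi 1 != 1], the sum must
   vanish. *)
have : S = psi 1 * S.
  rewrite {1}/S (reindex_inj (addIr x^-1)) mulr_sumr.
  apply: eq_bigr => k _; by rewrite mulrDl mulVf // psiD // mulrC.
move/eqP; rewrite -subr_eq0 -{1}[S]mul1r -mulrBl mulf_eq0 subr_eq0 eq_sym.
by rewrite (negPf psi1_neq1).
Qed.

End AdditiveCharacter.

(** * Enumeration and orthogonality of the characters of Z_p^* *)

Section Characters.

(** Since n is nonzero in the field, X^n - 1 is separable and has n distinct roots; a set of n
    distinct n-th roots of unity contains a primitive one. *)
Lemma closed_prim_root_exists (F : closedFieldType) (n : nat) :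
  (n%:R != 0 :> F) -> exists z : F, n.-primitive_root z.
Proof.
move=> n_neq0; have n_gt0 : (0 < n)%N by case: n n_neq0; rewrite ?eqxx.
have [r] := closed_field_poly_normal ('X^n - 1 : {poly F}).
rewrite (monicP _) ?monicXnsubC // scale1r => Dp.
have rn1: all n.-unity_root r by apply/allP=> z; rewrite -root_prod_XsubC -Dp.
have sz_r: (n < (size r).+1)%N.
  by rewrite -(size_prod_XsubC r id) -Dp size_XnsubC.
have [|z] := hasP (has_prim_root n_gt0 rn1 _ sz_r); last by exists z.
by rewrite -separable_prod_XsubC -Dp separable_Xn_sub_1.
Qed.

Variables (R : realType) (p : nat) (p_prime : prime p).

(** Z_p^* is cyclic, so a character is determined by its value at a generator [g], which may be any
    power of a primitive root of unity [w] of order p - 1. Listing the characters turns the finitely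
    supported sum of [step1] into an ordinary one. *)
Lemma char_group_enum :
  exists2 r : seq {ffun {unit 'F_p} -> R[i]},
    uniq r /\ char_group R p = [set` r] &
    forall x, \sum_(chi <- r) chi x = (p - 1)%:R * (x == 1%g)%:R.
Proof.
set n := (p - 1)%N.
have n_gt0 : (0 < n)%N by rewrite subn_gt0 prime_gt1.
have [w prim_w] : exists w : R[i], n.-primitive_root w.
  by apply: closed_prim_root_exists; rewrite pnatr_eq0 -lt0n.
have /cyclicP[g defG] := field_unit_group_cyclic [group of [set: {unit 'F_p}]].
have og : #[g]%g = n.
  by rewrite orderE -defG card_finField_unit card_Fp // -subn1.
(* [dl] is a discrete logarithm to base [g]. It is additive only modulo [n], which suffices because
   [g] and [w] both have order [n]. *)
have /choice[dl dlE] : forall x : {unit 'F_p}, exists a, x = (g ^+ a)%g.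
  by move=> x; apply/cycleP; rewrite -defG inE.
have w_dl a b : (g ^+ a == g ^+ b)%g = (w ^+ a == w ^+ b).
  by rewrite eq_expg_mod_order og (eq_prim_root_expr prim_w).
pose ch (j : 'I_n) := [ffun x => (w ^+ j) ^+ dl x].
have ch_g (j : 'I_n) : ch j g = w ^+ j.
  have /eqP := dlE g; rewrite -{1}(expg1 g) w_dl ffunE => /eqP.
  by rewrite exprAC => <-.
have norm_w : `|w| = 1.
  apply/eqP; rewrite -(@pexpr_eq1 _ _ n) ?normr_ge0 //.
  by rewrite -normrX prim_expr_order ?normr1.
exists [seq ch j | j <- enum 'I_n]; first split.
- rewrite map_inj_uniq ?enum_uniq // => i j.
  move=> /(congr1 (fun f : {ffun _ -> _} => f g)).
  rewrite !ch_g => /eqP; rewrite (eq_prim_root_expr prim_w) !modn_small //.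
  by move=> /eqP /val_inj.
- apply/seteqP; split=> chi /=; last first.
    move=> /mapP[j _ ->]; split=> [l|l l']; rewrite !ffunE.
      by rewrite !normrX ?norm_w !expr1n.
    rewrite -exprD -!exprM ![(j * _)%N]mulnC !exprM; congr (_ ^+ _).
    by apply/eqP; rewrite -w_dl expgD -!dlE.
  move=> [chi_norm chiM].
  have chi1 : chi 1%g = 1.
    have c1 : chi 1%g != 0 by rewrite -normr_eq0 chi_norm oner_eq0.
    by apply: (mulfI c1); rewrite -chiM mulg1 mulr1.
  have chiX a : chi (g ^+ a)%g = chi g ^+ a.
    by elim: a => [|a IHa]; rewrite ?expg0 // expgS chiM IHa exprS.
  have [|j chi_g] := prim_rootP prim_w (x := chi g).
    by rewrite -chiX -og expg_order.
  apply/mapP; exists j; first by rewrite mem_enum.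
  by apply/ffunP => x; rewrite {1}(dlE x) chiX chi_g ffunE.
move=> x; rewrite big_map big_enum /=.
under eq_bigr do rewrite ffunE exprAC.
have dlx1 : (x == 1%g) = (w ^+ dl x == 1).
  by rewrite {1}(dlE x) -(expg0 g) w_dl expr0.
have [x1|x1] := eqVneq x 1%g; move: dlx1; rewrite ?x1 ?eqxx ?(negPf x1).
  move/esym/eqP => ->; rewrite (eq_bigr (fun=> 1)) => [|i _]; last first.
    by rewrite expr1n.
  by rewrite sumr_const card_ord mulr1.
move/esym/negbT => wx1; apply/eqP; rewrite mulr0.
(* Geometric sum: its product with [w ^+ dl x - 1], which is nonzero, is
   [(w ^+ dl x) ^+ n - 1 = 0]. *)
have := subrX1 (w ^+ dl x) n.
rewrite exprAC (prim_expr_order prim_w) expr1n subrr.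
by move/esym/eqP; rewrite mulf_eq0 subr_eq0 (negPf wx1).
Qed.

End Characters.

(** * Spectral properties of the rank-one matrix f f^* *)

Section RankOne.
Variables (R : realType) (n : nat).
Implicit Types f h : 'cV[R[i]]_n.

Lemma hsdotE f h : hsdot f h = \sum_i f i 0 * (h i 0)^*.
Proof. by apply: eq_bigr => i _; rewrite !mxE big_ord1 !mxE. Qed.

Lemma hsdotC f h : hsdot h f = (hsdot f h)^*.
Proof.
rewrite !hsdotE rmorph_sum; apply: eq_bigr => i _.
by rewrite rmorphM /= conjCK mulrC.
Qed.

Lemma hsdotZl z f h : hsdot (z *: f) h = z * hsdot f h.
Proof. by rewrite /hsdot -scalemxAl mxtraceZ. Qed.

Lemma hsdotZ z f : hsdot (z *: f) (z *: f) = `|z| ^+ 2 * hsdot f f.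
Proof. by rewrite hsdotZl hsdotC hsdotZl rmorphM /= -hsdotC mulrA normCK. Qed.

Lemma hsdot_eq0 f : (hsdot f f == 0) = (f == 0).
Proof.
apply/eqP/eqP => [|->]; last by rewrite /hsdot mul0mx mxtrace0.
rewrite hsdotE => /psumr_eq0P f0; apply/colP => i; rewrite mxE.
have /eqP := f0 (fun i _ => mul_conjC_ge0 (f i 0)) i isT.
by rewrite mul_conjC_eq0 => /eqP.
Qed.

Lemma rank1_mulE f h : f *m map_mx Num.conj f^T *m h = hsdot h f *: f.
Proof.
rewrite -mulmxA [_ *m h]mx11_scalar mul_mx_scalar; congr (_ *: _).
by rewrite hsdotE mxE; apply: eq_bigr => i _; rewrite !mxE mulrC.
Qed.

Lemma hsdot_rank1 f h :
  hsdot (f *m map_mx Num.conj f^T *m h) h = `|hsdot f h| ^+ 2.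
Proof. by rewrite rank1_mulE hsdotZl hsdotC normCKC. Qed.

Variables (f : 'cV[R[i]]_n) (f_neq0 : f != 0).
Let A := f *m map_mx Num.conj f^T.

Let normf_neq0 : hsdot f f != 0. Proof. by rewrite hsdot_eq0. Qed.

Lemma rank1_eigen h mu : mu != 0 -> A *m h = mu *: h ->
  h = (hsdot h f / mu) *: f.
Proof.
by move=> mu_neq0; rewrite rank1_mulE mulrC -scalerA => ->; rewrite scalerK.
Qed.

(** The transpose appears because [eigenvalue] refers to row vectors: row eigenvectors of [A^T] are
    the transposes of column eigenvectors of [A]. *)
Lemma rank1_eigenvalue mu :
  mu != 0 -> eigenvalue A^T mu = (mu == hsdot f f).
Proof.
move=> mu_neq0; apply/eigenvalueP/eqP => [[v vA v_neq0]|->]; last first.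
  exists f^T; last by rewrite trmx_eq0.
  by rewrite -trmx_mul rank1_mulE linearZ.
have Av : A *m v^T = mu *: v^T by rewrite -[A]trmxK -trmx_mul vA linearZ.
have vE := rank1_eigen _ _ mu_neq0 Av.
(* Pairing v^T = (<v^T, f> / mu) f with [f] and cancelling the nonzero <v^T, f> gives mu = <f,
   f>. *)
have := congr1 (fun w => hsdot w f) vE; rewrite hsdotZl => cE.
have c_neq0 : hsdot v^T f != 0.
  apply: contraNneq v_neq0 => c0.
  by rewrite -trmx_eq0 vE c0 mul0r scale0r.
apply: (mulfI c_neq0); rewrite {1}cE -!mulrA; congr (_ * _).
by rewrite mulrC mulfK.
Qed.

(** The eigenvector equation makes [h] a multiple z f, and the trace of [A] is <f, f>, so the
    normalization says exactly |z| = 1. *)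
Lemma rank1_eigenvector h :
  (A *m h = hsdot f f *: h /\ hsdot h h = \tr A) <->
  (exists2 z : R[i], `|z| = 1 & h = z *: f).
Proof.
have trA : \tr A = hsdot f f by [].
rewrite trA; split=> [[Ah]|[z z1 ->]]; last first.
  by rewrite rank1_mulE hsdotZ hsdotZl z1 expr1n mul1r scalerA mulrC.
have hE := rank1_eigen _ _ normf_neq0 Ah.
rewrite {1 2}hE hsdotZ -[RHS]mul1r => /(mulIf normf_neq0) /eqP.
rewrite sqrp_eq1 ?normr_ge0 // => /eqP z1.
by exists (hsdot h f / hsdot f f).
Qed.

End RankOne.

(** * Fourier analysis of F and the three reconstruction steps *)

Section Reconstruction.
Variables (R : realType) (p : nat) (p_prime : prime p) (p_gt2 : (2 < p)%N).
Local Notation C := R[i].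
Local Notation psi := (psi R p).

Lemma pi0E (g : aff p) i j :
  pi0 R g i j = psi (g.1 * el1 p i) * (pos1 (val g.2 * el1 p i) == j)%:R.
Proof. by rewrite !mxE eqxx andbT. Qed.

Lemma pi0_mulE (g : aff p) (phi : 'cV[C]_(dim1 p)) i :
  (pi0 R g *m phi) i 0 =
  psi (g.1 * el1 p i) * phi (pos1 (val g.2 * el1 p i)) 0.
Proof.
rewrite mxE (bigD1 (pos1 (val g.2 * el1 p i))) //= pi0E eqxx mulr1.
rewrite big1 ?addr0 // => j neq_j.
by rewrite pi0E eq_sym (negPf neq_j) mulr0 mul0r.
Qed.

Lemma sum_delta (I : finType) (a : I) (f : I -> C) :
  \sum_i f i * (a == i)%:R = f a.
Proof.
rewrite (bigD1 a) //= eqxx mulr1 big1 ?addr0 // => i neq_i.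
by rewrite eq_sym (negPf neq_i) mulr0.
Qed.

Lemma Omega0_tr_mulE m (X : 'M[C]_(m, dim1 p)) i j :
  (X *m (Omega0 R p)^T) i j = X i (pos1 (- el1 p j)).
Proof.
rewrite mxE -[RHS]sum_delta; apply: eq_bigr => k _.
by rewrite !mxE eqxx andbT.
Qed.

(** [Omega1] is a permutation matrix: s = 1 + t^-1 is solved by t = (s - 1)^-1, which avoids 0 and
    -1 because s is neither 1 nor 0. *)
Lemma Omega1_mulE m (X : 'M[C]_(m, dim2 p)) i (s : 'I_(dim2 p)) :
  (X *m Omega1 R p) i s = X i (pos_dim2 p (el2 p s - 1)^-1).
Proof.
have [s_neq0 s_neq1] := el2_neq _ p_prime p_gt2 s.
have s1_neq0 : el2 p s - 1 != 0 by rewrite subr_eq0.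
rewrite mxE -[RHS]sum_delta; apply: eq_bigr => k _.
rewrite !mxE eqxx andbT; congr (_ * (nat_of_bool _)%:R).
have k_neq0 : el1 p k != 0 by rewrite el1_neq0 ?ltn_dim2.
have k'_neq0 : 1 + (el1 p k)^-1 != 0.
  rewrite -(inj_eq (mulIf k_neq0)) mulrDl mul1r mulVf // mul0r.
  exact: el1_dim2_neq.
have k'_neq1 : 1 + (el1 p k)^-1 != 1.
  by rewrite -subr_eq0 addrAC subrr add0r invr_eq0.
have s'_neqN1 : (el2 p s - 1)^-1 + 1 != 0.
  rewrite -(inj_eq (mulIf s1_neq0)) mulrDl mul1r mulVf // mul0r.
  by rewrite addrC subrK.
rewrite eq_sym -(inj_eq (el2_inj p p_prime _ (ltn_dim1 p p_gt2))) pos2K //.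
rewrite -(inj_eq (el1_inj p p_prime _ (ltn_dim2 p p_gt2))).
rewrite pos_dim2K ?invr_eq0 //.
by rewrite -[RHS](inj_eq invr_inj) invrK subr_eq [1 + _]addrC.
Qed.

Section Coefficients.
Variables (phi : 'cV[C]_(dim1 p)) (A : 'M[C]_(dim1 p)).

Let F (g : aff p) := hsdot (A *m (pi0 R g *m phi)) (pi0 R g *m phi).

(** The (m, n) term of F(k, l) without its phase, the only factor that depends on k. *)
Let coef l m n :=
  A m n * (phi (pos1 (l * el1 p n)) 0 * (phi (pos1 (l * el1 p m)) 0)^*).

Lemma F_expand g :
  F g = \sum_(mn : 'I_(dim1 p) * 'I_(dim1 p))
          psi (g.1 * (el1 p mn.2 - el1 p mn.1)) * coef (val g.2) mn.1 mn.2.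
Proof.
rewrite /F hsdotE -(pair_bigA _ (fun m n =>
  psi (g.1 * (el1 p n - el1 p m)) * coef (val g.2) m n)) /=.
apply: eq_bigr => m _; rewrite mxE mulr_suml; apply: eq_bigr => n _.
rewrite !pi0_mulE rmorphM /= psi_conj // mulrBr psiD // /coef.
ring.
Qed.

(** The total phase of the (m, n) term is psi(k (y + n - m)), whose sum over k vanishes unless m - n
    = y. *)
Lemma F_fourier (l : {unit 'F_p}) (y : 'F_p) :
  \sum_k psi (k * y) * F (k, l) =
  p%:R * \sum_(mn : 'I_(dim1 p) * 'I_(dim1 p) | el1 p mn.1 - el1 p mn.2 == y)
    coef (val l) mn.1 mn.2.
Proof.
under eq_bigr do rewrite F_expand mulr_sumr.
rewrite exchange_big [in RHS]big_mkcond mulr_sumr.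
apply: eq_bigr => -[m n] _ /=.
under eq_bigr do rewrite mulrA -psiD // -mulrDr.
rewrite -mulr_suml psi_sum // -[el1 p n - _]opprB subr_eq0 eq_sym.
by case: eqP; rewrite ?mulr0 ?mulr1 ?mul0r.
Qed.

Lemma chi_tildeE chi : char_group R p chi ->
  chi_tilde chi F = p%:R * c_coef phi chi *
    \sum_m A m m * chi (unit1 (pos1 (- el1 p m)))^-1%g.
Proof.
move=> [_ chiM]; rewrite /chi_tilde.
have diag (l : {unit 'F_p}) : \sum_k F (k, l) = p%:R * \sum_m coef (val l) m m.
  transitivity (\sum_k psi (k * 0) * F (k, l)).
    by apply: eq_bigr => k _; rewrite mulr0 psi0 mul1r.
  rewrite F_fourier; congr (_ * _).
  rewrite (reindex_onto (fun m => (m, m)) fst) /=; last first.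
    move=> [m n] /=; rewrite subr_eq0 => /eqP.
    by move=> /(el1_inj p p_prime _ (ltn_dim1 p p_gt2)) ->.
  by apply: eq_bigl => m; rewrite subrr !eqxx.
under eq_bigr do rewrite diag -mulrA mulr_suml.
rewrite -mulr_sumr -mulrA; congr (_ * _).
rewrite exchange_big mulr_sumr; apply: eq_bigr => m _ /=.
set u := unit1 _.
have val_u : val u = - el1 p m.
  by rewrite val_unit1 // pos1K // oppr_eq0 el1_neq0 // ltn_dim1.
(* With u = -m, replacing l by l u^-1 turns phi(lm) into phi(-l) and splits off the factor
   chi(u^-1), so the sum over l becomes [c_coef phi chi]. *)
rewrite /c_coef /coef mulr_suml (reindex_inj (mulIg u^-1)%g).
apply: eq_bigr => l _.
have -> : val (l * u^-1)%g * el1 p m = - val l.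
  have <- : val (l * u^-1)%g * val u = val l := congr1 val (mulgKV u l).
  by rewrite val_u mulrN opprK.
by rewrite chiM normCK; ring.
Qed.

Lemma pi0_hatE (i j : 'I_(dim1 p)) :
  pi0_hat F i (pos1 (- el1 p j)) = p%:R *
    \sum_(mn : 'I_(dim1 p) * 'I_(dim1 p) | el1 p mn.1 - el1 p mn.2 == el1 p i)
      coef (- (el1 p j / el1 p i)) mn.1 mn.2.
Proof.
have i_neq0 : el1 p i != 0 by rewrite el1_neq0 ?ltn_dim1.
have j_neq0 : - el1 p j != 0 by rewrite oppr_eq0 el1_neq0 ?ltn_dim1.
(* Row i of [pi0] at (k, l) has its only nonzero entry in column li; this is column -j exactly for l
   = -j/i. *)
pose l0 := unit1 (pos1 (- (el1 p j / el1 p i))).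
have val_l0 : val l0 = - (el1 p j / el1 p i).
  by rewrite val_unit1 // pos1K // -mulNr mulf_neq0 ?invr_eq0.
rewrite -val_l0 -F_fourier /pi0_hat summxE.
under eq_bigr do rewrite mxE pi0E mulrA.
rewrite -(pair_bigA _ (fun k l => F (k, l) * psi (k * el1 p i)
   * (pos1 (val l * el1 p i) == pos1 (- el1 p j))%:R)) /=.
apply: eq_bigr => k _; rewrite [RHS]mulrC.
rewrite -[RHS](sum_delta _ l0 (fun l => F (k, l) * psi (k * el1 p i))).
apply: eq_bigr => l _; congr (_ * (nat_of_bool _)%:R).
rewrite -(inj_eq (el1_inj p p_prime _ (ltn_dim1 p p_gt2))).
rewrite !pos1K // ?mulf_neq0 ?unit_neq0 // eq_sym.
rewrite -[RHS](inj_eq val_inj) [in RHS]/= val_l0.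
by rewrite -[RHS](inj_eq (mulIf i_neq0)) mulNr divfK.
Qed.

Lemma pi0_hat_Omega0 :
  pi0_hat F *m (Omega0 R p)^T = p%:R *:
  ((\matrix_(i, t) A (pos1 (- (el1 p i * el1 p t)))
                     (pos1 (- (el1 p i * (el1 p t + 1)))))
    *m map_mx Num.conj (Bmx phi)^T).
Proof.
apply/matrixP => i j; rewrite Omega0_tr_mulE pi0_hatE !mxE; congr (_ * _).
have i_neq0 : el1 p i != 0 by rewrite el1_neq0 ?ltn_dim1.
have t_neq0 (t : 'I_(dim2 p)) : el1 p t != 0 by rewrite el1_neq0 ?ltn_dim2.
have t1_neq0 := el1_dim2_neq p p_prime p_gt2.
(* Parametrization of the pairs with m - n = i by m = -it, n = -i(t + 1), with inverse t = -m/i.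
   Both m and n are nonzero exactly when t is neither 0 nor -1, which leaves t in {1,...,p-2}. *)
pose mn_of (t : 'I_(dim2 p)) := (pos1 (- (el1 p i * el1 p t)) : 'I_(dim1 p),
   pos1 (- (el1 p i * (el1 p t + 1))) : 'I_(dim1 p)).
have mnE1 t : el1 p (mn_of t).1 = - (el1 p i * el1 p t).
  by rewrite pos1K // oppr_eq0 mulf_neq0.
have mnE2 t : el1 p (mn_of t).2 = - (el1 p i * (el1 p t + 1)).
  by rewrite pos1K // oppr_eq0 mulf_neq0.
rewrite (reindex_onto mn_of (fun mn => pos_dim2 p (- (el1 p mn.1 / el1 p i)))).
  apply: eq_big => [t|t _].
    rewrite mnE1 mnE2; apply/andP; split; first by apply/eqP; ring.
    rewrite mulNr opprK mulrAC mulfV // mul1r.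
    by apply/eqP/(el1_inj p p_prime _ (ltn_dim2 p p_gt2)); rewrite pos_dim2K.
  rewrite /coef mnE1 mnE2 !mxE rmorphM /= conjCK.
  have -> : - (el1 p j / el1 p i) * - (el1 p i * el1 p t) = el1 p j * el1 p t
    by rewrite mulrNN mulrA divfK.
  have -> : - (el1 p j / el1 p i) * - (el1 p i * (el1 p t + 1)) =
      el1 p j * (el1 p t + 1)
    by rewrite mulrNN mulrA divfK.
  ring.
move=> [m n] /= /eqP mnE.
have m_neq0 : el1 p m != 0 by rewrite el1_neq0 ?ltn_dim1.
have n_neq0 : el1 p n != 0 by rewrite el1_neq0 ?ltn_dim1.
have t1E : - (el1 p m / el1 p i) + 1 = - (el1 p n / el1 p i).
  by apply: (mulIf i_neq0); rewrite mulrDl !mulNr !divfK // -mnE; ring.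
have tK : el1 p (pos_dim2 p (- (el1 p m / el1 p i))) = - (el1 p m / el1 p i).
  by apply: pos_dim2K; rewrite // ?t1E oppr_eq0 mulf_neq0 ?invr_eq0.
by rewrite /mn_of tK t1E !mulrN !opprK ![_ * (_ / _)]mulrC !divfK // !el1K.
Qed.

Hypothesis c_neq0 : forall chi, char_group R p chi -> c_coef phi chi != 0.

Lemma step1E k : step1 phi F k 0 = A (pos1 (- el1 p k)) (pos1 (- el1 p k)).
Proof.
have [r [r_uniq char_r] sum_r] := char_group_enum R p p_prime.
rewrite mxE char_r -fsbig_seq //.
pose u (m : 'I_(dim1 p)) : {unit 'F_p} := unit1 (pos1 (- el1 p m)).
transitivity ((p * (p - 1))%:R^-1 * (\sum_(chi <- r)
    \sum_m p%:R * A m m * chi ((u m)^-1 * unit1 k)%g)).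
  congr (_ * _); rewrite !big_seq; apply: eq_bigr => chi chi_r.
  have chi_char : char_group R p chi by rewrite char_r.
  rewrite chi_tildeE // -(mulrA p%:R) (mulrCA p%:R) mulKf ?c_neq0 //.
  rewrite mulr_sumr mulr_suml; apply: eq_bigr => m _.
  by case: chi_char => _ ->; rewrite -!mulrA.
rewrite exchange_big /=.
under eq_bigr do rewrite -mulr_sumr sum_r.
(* Orthogonality keeps only the m with u(m) = k, that is m = -k, with weight p(p - 1), which the
   prefactor of [step1] cancels. *)
rewrite -(sum_delta _ (pos1 (- el1 p k)) (fun m => A m m)) mulr_sumr.
apply: eq_bigr => m _.
have -> : ((u m)^-1 * unit1 k == 1)%g = (pos1 (- el1 p k) == m).
  rewrite -eq_mulVg1 -(inj_eq val_inj) /= !val_unit1 //.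
  rewrite -(inj_eq (el1_inj p p_prime _ (ltn_dim1 p p_gt2))).
  by rewrite !pos1K ?oppr_eq0 ?el1_neq0 ?ltn_dim1 // eqr_oppLR eq_sym.
have p0 : p%:R != 0 :> C by rewrite pnatr_eq0 -lt0n prime_gt0.
have p10 : (p - 1)%:R != 0 :> C by rewrite pnatr_eq0 -lt0n subn_gt0 prime_gt1.
rewrite natrM; move: p0 p10; move: (p%:R : C) ((p - 1)%:R : C) => x y x0 y0.
by field; rewrite x0 y0.
Qed.

Lemma Sop_reconstruct (Bd : 'M[C]_(dim2 p, dim1 p)) : Bd *m Bmx phi = 1%:M ->
  row_mx (step1 phi F) (step2 Bd F) = Sop A.
Proof.
move=> Bd_left; apply/matrixP => i j; rewrite [RHS]mxE; cbv zeta.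
(* The left block is the column carrying 1; column s of the right block carries [el2 p s]. *)
case: (@split_ordP 1 (dim2 p) j) => s ->.
  have el1E : el1 p (lshift (dim2 p) s : 'I_(dim1 p)) = 1 by rewrite (ord1 s).
  by rewrite el1E row_mxEl (ord1 s) step1E eqxx.
rewrite row_mxEr /step2 pi0_hat_Omega0 -!scalemxAl scalerA.
rewrite mulVf ?scale1r; last by rewrite pnatr_eq0 -lt0n prime_gt0.
(* The adjoint of the left inverse is a right inverse of the adjoint of [Bmx phi]. *)
have Bd_right : map_mx Num.conj (Bmx phi)^T *m map_mx Num.conj Bd^T = 1%:M.
  by rewrite -map_mxM -trmx_mul Bd_left trmx1 map_mx1.
rewrite -[X in (X *m Omega1 R p) _ _]mulmxA Bd_right mulmx1.
rewrite Omega1_mulE mxE.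
have el2E : el1 p (rshift 1 s : 'I_(dim1 p)) = el2 p s by [].
have [s_neq0 s_neq1] := el2_neq p p_prime p_gt2 s.
rewrite el2E (negPf s_neq1).
have s1_neq0 : el2 p s - 1 != 0 by rewrite subr_eq0.
(* At t = 1/(s - 1), the indices -it and -i(t + 1) become i/(1 - s) and is/(1 - s), as in [Sop]. *)
have sE : (el2 p s - 1)^-1 + 1 = el2 p s * (el2 p s - 1)^-1.
  by apply: (mulIf s1_neq0); rewrite mulrDl mulVf // divfK // mul1r addrC subrK.
rewrite pos_dim2K ?invr_eq0 // ?sE ?mulf_neq0 ?invr_eq0 //.
by rewrite -[1 - _]opprB invrN !mulrN mulrA.
Qed.

End Coefficients.

Lemma SopK : cancel (@Sop R p) (@Sadj R p).
Proof.
move=> A; apply/matrixP => i j; rewrite mxE; cbv zeta.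
have i_neq0 : el1 p i != 0 by rewrite el1_neq0 ?ltn_dim1.
have j_neq0 : el1 p j != 0 by rewrite el1_neq0 ?ltn_dim1.
have [ji|neq_ji] := eqVneq (el1 p j) (el1 p i).
  rewrite mxE; cbv zeta.
  rewrite pos1K ?oner_eq0 // eqxx pos1K ?oppr_eq0 // opprK.
  by rewrite el1K // -(el1_inj p p_prime _ (ltn_dim1 p p_gt2) _ _ ji).
have d_neq0 : el1 p i - el1 p j != 0 by rewrite subr_eq0 eq_sym.
have q_neq0 : (el1 p i)^-1 * el1 p j != 0 by rewrite mulf_neq0 ?invr_eq0.
have q_neq1 : (el1 p i)^-1 * el1 p j != 1.
  by rewrite -(inj_eq (mulfI i_neq0)) mulrA mulfV // mul1r mulr1.
rewrite mxE; cbv zeta; rewrite !pos1K // (negPf q_neq1).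
(* Off the diagonal, [Sadj] reads row i - j and column j/i. There [Sop] reads row (i - j)/(1 - j/i)
   = i, and its column index is this times j/i, namely j. *)
have E : (el1 p i - el1 p j) * (1 - (el1 p i)^-1 * el1 p j)^-1 = el1 p i.
  have q'_neq0 : 1 - (el1 p i)^-1 * el1 p j != 0 by rewrite subr_eq0 eq_sym.
  apply: (mulIf q'_neq0); rewrite mulfVK // mulrBr mulr1.
  by rewrite mulrA mulfV // mul1r.
by rewrite mulrAC E mulrA mulfV // mul1r !el1K.
Qed.

End Reconstruction.

Theorem corollary6p6 (R : realType) (p : nat) (p_prime : prime p)
    (p_gt2 : (2 < p)%N) (phi : 'cV[R[i]]_(dim1 p))
    (c_neq0 : forall chi, char_group R p chi -> c_coef phi chi != 0)
    (Bd : 'M[R[i]]_(dim2 p, dim1 p)) (Bd_left : Bd *m Bmx phi = 1%:M) :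
  (forall A : 'M[R[i]]_(dim1 p),
     reconstruct phi Bd
       (fun g => hsdot (A *m (pi0 R g *m phi)) (pi0 R g *m phi)) = A)
  /\
  (forall f : 'cV[R[i]]_(dim1 p), f != 0 ->
     let A := reconstruct phi Bd
                (fun g => `|hsdot f (pi0 R g *m phi)| ^+ 2) in
     exists lambda : R[i],
       [/\ lambda != 0,
           forall mu, mu != 0 -> eigenvalue A^T mu = (mu == lambda) &
           forall h : 'cV[R[i]]_(dim1 p),
             (A *m h = lambda *: h /\ hsdot h h = \tr A) <->
             (exists2 z : R[i], `|z| = 1 & h = z *: f)]).
Proof.
have recA A : reconstruct phi Bd
    (fun g => hsdot (A *m (pi0 R g *m phi)) (pi0 R g *m phi)) = A.
  by rewrite /reconstruct Sop_reconstruct // SopK.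
split=> // f f_neq0 A.
have -> : A = f *m map_mx Num.conj f^T.
  rewrite -[RHS]recA /A; congr (reconstruct _ _ _); apply/funext => g.
  by rewrite hsdot_rank1.
exists (hsdot f f); split; first by rewrite hsdot_eq0.
- by move=> mu; apply: rank1_eigenvalue.
- by move=> h; apply: rank1_eigenvector.
Qed.
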